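(* The category $\mathbf{Clus}$ of rooted cluster algebras and rooted cluster morphisms does not generally admit products; that is, there exist two rooted cluster algebras which have no product in $\mathbf{Clus}$.
   Context: Countable means of cardinality at most $\aleph_0$; rings are unital and ring homomorphisms preserve identities. A seed is a triple $\Sigma=(\mathbf{x},\mathbf{ex},B)$ where $\mathbf{x}$ is a countable set of indeterminates over $\mathbb{Z}$ (the cluster), $\mathbf{ex}\subset\mathbf{x}$ is the set of exchangeable variables (those in $\mathbf{x}\setminus\mathbf{ex}$ are frozen), and $B=(b_{xy})_{x,y\in\mathbf{x}}$ is an integer matrix which is locally finite (each row and column has finite support) and skew-symmetrisable (there are positive integers $d_x$ with $d_xb_{xy}=-d_yb_{yx}$). Put $\mathcal{F}_\Sigma=\mathbb{Q}(x\mid x\in\mathbf{x})$. For $x\in\mathbf{ex}$ the mutation $\mu_x(\Sigma)=(\mathbf{x}',\mathbf{ex}',B')$ is obtained by replacing $x$ in $\mathbf{x}$ and in $\mathbf{ex}$ by $x'\in\mathcal{F}_\Sigma$ with $xx'=\prod_{b_{xy}>0}y^{b_{xy}}+\prod_{b_{xy}<0}y^{-b_{xy}}$, and (identifying the index $x'$ with $x$) $b'_{yz}=-b_{yz}$ if $x\in\{y,z\}$ and $b'_{yz}=b_{yz}+\frac12(|b_{yx}|b_{xz}+b_{yx}|b_{xz}|)$ otherwise. For $y\in\mathbf{x}$, $\mu_{x,\Sigma}(y)$ is the variable of $\mu_x(\Sigma)$ corresponding to $y$: it is $y$ if $y\ne x$ and $x'$ if $y=x$. A sequence $(x_1,\dots,x_l)$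 is $\Sigma$-admissible if $x_1$ is exchangeable in $\Sigma$ and each $x_i$ ($i\ge2$) is exchangeable in $\mu_{x_{i-1}}\circ\cdots\circ\mu_{x_1}(\Sigma)$; $\mu_{x_l}\circ\cdots\circ\mu_{x_1,\Sigma}(y)$ denotes the variable corresponding to $y\in\mathbf{x}$ after these mutations. $\mathrm{Mut}(\Sigma)$ is the set of seeds obtained from $\Sigma$ by mutating along finite (possibly empty) admissible sequences. The rooted cluster algebra $\mathcal{A}(\Sigma)$ is the $\mathbb{Z}$-subalgebra of $\mathcal{F}_\Sigma$ generated by all variables in clusters of seeds in $\mathrm{Mut}(\Sigma)$, considered together with its initial seed $\Sigma$. For seeds $\Sigma=(\mathbf{x},\mathbf{ex},B)$, $\Sigma'=(\mathbf{x}',\mathbf{ex}',B')$ and a map $f:\mathcal{A}(\Sigma)\to\mathcal{A}(\Sigma')$, a sequence $(x_1,\dots,x_n)$ is $(f,\Sigma,\Sigma')$-biadmissible if it is $\Sigma$-admissible and $(f(x_1),\dots,f(x_n))$ is $\Sigma'$-admissible. A rooted cluster morphism $\mathcal{A}(\Sigma)\to\mathcal{A}(\Sigma')$ is a ring homomorphism $f$ such that (CM1) $f(\mathbf{x})\subset\mathbf{x}'\sqcup\mathbb{Z}$; (CM2) $f(\mathbf{ex})\subset\mathbf{ex}'\sqcup\mathbb{Z}$; (CM3) for every $(f,\Sigma,\Sigma')$-biadmissible sequence $(x_1,\dots,x_n)$ and every $y\in\mathbf{x}$, $f(\mu_{x_n}\circ\cdots\circ\mu_{x_1,\Sigma}(y))=\mu_{f(x_n)}\circ\cdots\circ\mu_{f(x_1),\Sigma'}(f(y))$,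 where mutations fix integers. $\mathbf{Clus}$ is the category whose objects are rooted cluster algebras and whose morphisms are rooted cluster morphisms. *)

(* Defs.v *)
From HB Require Import structures.
From mathcomp Require Import all_boot all_order all_algebra finmap.
From mathcomp Require Import monalg.
From mathcomp Require Import boolp classical_sets functions cardinality fsbigop.
Set Implicit Arguments.
Unset Strict Implicit.
Unset Printing Implicit Defensive.
Import Order.TTheory GRing.Theory Num.Theory.
Local Open Scope ring_scope.
Local Open Scope classical_set_scope.

(* Q[x_i | i in I], for a countable (possibly empty or infinite) set I; shown*)
(* below to be an integral domain, so that its field of fractions is available*)
Definition cpoly (I : countType) := {malg rat[{cmonom I}]}.

HB.instance Definition _ (I : countType) := GRing.ComNzRing.on (cpoly I).

Section CpolyDomain.
Variable I : countType.
Implicit Types (p q : cpoly I) (m : {cmonom I}).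

(* Kronecker substitution x_i |-> X ^ (N ^ pickle i), on finitely many i     *)
Definition kron_digit m (k : nat) : nat :=
  if pickle_inv k is Some i then m i else 0%N.

Definition kron_exp (N K : nat) m : nat :=
  (\sum_(k < K) kron_digit m k * N ^ k)%N.

Definition kron_mon (N K : nat) m : {poly rat} := 'X^(kron_exp N K m).

Lemma kron_mon_morph N K : mmorphism (kron_mon N K).
Proof.
split=> [m1 m2|]; rewrite /kron_mon /kron_exp.
  rewrite -exprD -big_split /=; congr ('X^_); apply: eq_bigr => k _.
  by rewrite -mulnDl /kron_digit; case: pickle_inv => // i; rewrite cmM.
rewrite big1 ?expr0 // => k _.
by rewrite /kron_digit; case: pickle_inv => // i; rewrite cm1.
Qed.

HB.instance Definition _ N K :=
  isMultiplicative.Build {cmonom I} {poly rat} (kron_mon N K)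
    (kron_mon_morph N K).

Lemma digits_inj (N K : nat) (d e : nat -> nat) :
    (forall k, (k < K)%N -> (d k < N)%N) -> (forall k, (k < K)%N -> (e k < N)%N) ->
    (\sum_(k < K) d k * N ^ k = \sum_(k < K) e k * N ^ k)%N ->
  forall k, (k < K)%N -> d k = e k.
Proof.
elim: K d e => // K IH d e dN eN.
rewrite !big_ord_recl /= !expn0 !muln1.
have shift (g : nat -> nat) : (\sum_(i < K) g (bump 0 i) * N ^ bump 0 i
    = N * \sum_(i < K) g i.+1 * N ^ i)%N.
  rewrite big_distrr /=; apply: eq_bigr => i _.
  by rewrite /bump leq0n add1n expnS mulnCA.
rewrite !shift => E.
have N0 : (0 < N)%N by apply: leq_ltn_trans (dN 0%N _).
have E0 : d 0%N = e 0%N.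
  move: (congr1 (modn^~ N) E); rewrite ![(_ + N * _)%N]addnC.
  by rewrite ![(N * _)%N]mulnC !modnMDl !modn_small //; [apply: eN|apply: dN].
have ES : (\sum_(i < K) d i.+1 * N ^ i = \sum_(i < K) e i.+1 * N ^ i)%N.
  by move: E; rewrite E0 => /addnI/eqP; rewrite eqn_pmul2l // => /eqP.
case=> // k kK.
exact: (IH (fun k => d k.+1) (fun k => e k.+1)
           (fun k => dN k.+1) (fun k => eN k.+1) ES).
Qed.

Definition kron_bound p : nat :=
  \max_(m <- msupp p) \max_(i <- finsupp m) maxn (choice.pickle i) (m i).

Lemma kron_boundP p m i : m \in msupp p -> i \in finsupp m ->
  (choice.pickle i <= kron_bound p)%N /\ (m i <= kron_bound p)%N.
Proof.
move=> mp im; apply/andP; rewrite -geq_max /kron_bound.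
rewrite (big_rem m) //= (big_rem i) //=.
by rewrite -maxnA leq_max leqnn.
Qed.

Lemma kron_neq0 p B : p != 0 -> (kron_bound p < B)%N ->
  mmap (@polyC rat) (kron_mon B B) p != 0.
Proof.
move=> p0 pB; have [m0 m0p] : exists m, m \in msupp p.
  apply/fset0Pn; apply: contraNneq p0 => p0.
  by apply/eqP/malgP => m; rewrite mcoeff0 mcoeff_outdom // p0.
have dB m : m \in msupp p -> forall k, (kron_digit m k < B)%N.
  move=> mp k; rewrite /kron_digit; case: pickle_inv => [i|]; last first.
    exact: leq_ltn_trans pB.
  case: mdomP => [im|_]; last exact: leq_ltn_trans pB.
  exact: leq_ltn_trans (kron_boundP mp im).2 pB.
have inj m : m \in msupp p -> kron_exp B B m = kron_exp B B m0 -> m = m0.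
  move=> mp E; apply/eqP/cmP => i.
  have D := digits_inj (fun k _ => dB m mp k) (fun k _ => dB m0 m0p k) E.
  have [iB|iB] := ltnP (choice.pickle i) B.
    by move: (D _ iB); rewrite /kron_digit pickleK_inv.
  have out m' : m' \in msupp p -> m' i = 0%N.
    move=> m'p; case: mdomP => // im.
    have := leq_trans iB (kron_boundP m'p im).1.
    by rewrite leqNgt pB.
  by rewrite !out.
apply/eqP => /(congr1 (fun q : {poly rat} => q`_(kron_exp B B m0))).
rewrite mmapE coef_sum coef0 (big_rem m0) //= coefCM coefXn eqxx mulr1.
rewrite big_seq big1 => [|m]; last first.
  rewrite mem_rem_uniq ?fset_uniq // inE => /andP[mm0 mp].
  rewrite coefCM coefXn; case: eqP => [E|]; last by rewrite mulr0.
  by rewrite (inj m) ?eqxx in mm0.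
by rewrite addr0 => /eqP; rewrite mcoeff_eq0 m0p.
Qed.

Lemma cpoly_integral p q : p * q = 0 -> (p == 0) || (q == 0).
Proof.
move=> pq0; apply/negPn/negP; rewrite negb_or => /andP[p0 q0].
pose B := (maxn (kron_bound p) (kron_bound q)).+1.
have pB : (kron_bound p < B)%N by rewrite ltnS leq_maxl.
have qB : (kron_bound q < B)%N by rewrite ltnS leq_maxr.
have := mulf_neq0 (kron_neq0 p0 pB) (kron_neq0 q0 qB).
by rewrite -rmorphM /= pq0 mmap0 eqxx.
Qed.

Definition cpoly_unit : {pred cpoly I} := fun p => `[< exists q, q * p = 1 >].

Definition cpoly_inv p : cpoly I :=
  if pselect (exists q, q * p = 1) is left ex then projT1 (cid ex) else p.

Lemma cpoly_mulVr : {in cpoly_unit, left_inverse 1 cpoly_inv *%R}.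
Proof.
move=> p /asboolP h; rewrite /cpoly_inv; case: pselect => // ex.
by case: cid.
Qed.

Lemma cpoly_unitP p q : q * p = 1 -> p \in cpoly_unit.
Proof. by move=> h; apply/asboolP; exists q. Qed.

Lemma cpoly_inv_out : {in [predC cpoly_unit], cpoly_inv =1 id}.
Proof.
move=> p /asboolP h; rewrite /cpoly_inv; case: pselect => // ex.
Qed.

HB.instance Definition _ := GRing.ComNzRing_hasMulInverse.Build (cpoly I)
  cpoly_mulVr cpoly_unitP cpoly_inv_out.
HB.instance Definition _ := GRing.ComUnitRing_isIntegral.Build (cpoly I)
  cpoly_integral.
End CpolyDomain.

Definition ratfun (I : countType) := {fraction (cpoly I)}.
HB.instance Definition _ (I : countType) := GRing.Field.on (ratfun I).

(* locked because comparing two [ucm] by conversion is very slow              *)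
HB.lock Definition indet (I : countType) (i : I) : ratfun I :=
  FracField.tofrac (<< 1 *g ucm i >> : cpoly I).

(* The cluster is the family of indeterminates [indet i], i in [seed_idx].   *)
Record seed := Seed {
  seed_idx : countType;
  exch : set seed_idx;
  exmat : seed_idx -> seed_idx -> int;
  exmat_row_finite : forall x, finite_set [set y | exmat x y != 0];
  exmat_col_finite : forall y, finite_set [set x | exmat x y != 0];
  exmat_skew_symmetrisable : exists d : seed_idx -> nat,
    (forall x, (0 < d x)%N) /\
    (forall x y, (d x)%:Z * exmat x y = - ((d y)%:Z * exmat y x))
}.

Definition ambient (S : seed) : fieldType := ratfun (seed_idx S).

(* A seed reached by mutation: its variables are elements of the             *)
(* ambient field of the initial seed, still indexed by the variables of the  *)
(* initial seed (the index x' is identified with x). Local finiteness and    *)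
(* skew-symmetrisability are inherited from the initial seed.                *)
Record mseed (S : seed) := MSeed {
  mvar : seed_idx S -> ambient S;
  mexch : set (seed_idx S);
  mmat : seed_idx S -> seed_idx S -> int
}.

Definition initial (S : seed) : mseed S :=
  MSeed (@indet (seed_idx S)) (@exch S) (@exmat S).

Section Mutation.
Variable S : seed.
Implicit Types (M : mseed S) (x y z : seed_idx S) (u v : ambient S).

Definition new_var M x : ambient S :=
  (\big[*%R/1]_(y \in [set y | 0 < mmat M x y]) (mvar M y ^ mmat M x y)
   + \big[*%R/1]_(y \in [set y | mmat M x y < 0]) (mvar M y ^ (- mmat M x y)))
  / mvar M x.

(* the numerator is even, so the division by 2 is exact                      *)
Definition new_mat M x y z : int :=
  if (x == y) || (x == z) then - mmat M y z
  else mmat M y z +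
    ((`|mmat M y x| * mmat M x z + mmat M y x * `|mmat M x z|) %/ 2)%Z.

Definition mutate_at M x : mseed S :=
  MSeed (fun y => if y == x then new_var M x else mvar M y)
        (mexch M) (new_mat M x).

(* the index of u among the variables of M, if u is one of them              *)
Definition position M u : option (seed_idx S) :=
  if pselect (exists x, mvar M x == u) is left h then Some (xchoose h) else None.

(* mu_u(M) for u an exchangeable variable of M; otherwise the junk value M   *)
Definition mutate M u : mseed S :=
  if position M u is Some x then
    if x \in mexch M then mutate_at M x else M
  else M.

Definition mutate_seq M (s : seq (ambient S)) : mseed S := foldl mutate M s.

Fixpoint admissible M (s : seq (ambient S)) : Prop :=
  if s is u :: s' then
    (exists2 x, mexch M x & mvar M x = u) /\ admissible (mutate M u) s'
  else True.

Definition Mut : set (mseed S) :=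
  [set M | exists2 s, admissible (initial S) s & M = mutate_seq (initial S) s].

Definition cluster_variable : set (ambient S) :=
  [set u | exists2 M, Mut M & exists x, mvar M x = u].

(* the subring of the ambient field generated by the cluster variables       *)
Definition cluster_subring : {pred ambient S} := fun u =>
  `[< forall R : {pred ambient S}, subring_closed R ->
        (forall v, cluster_variable v -> v \in R) -> u \in R >].

Lemma cluster_subringP : subring_closed cluster_subring.
Proof.
split=> [|u v /asboolP hu /asboolP hv|u v /asboolP hu /asboolP hv];
  apply/asboolP => R RP gR.
- by case: RP.
- by case: (RP) => _ RB _; apply: RB; [apply: hu|apply: hv].
- by case: (RP) => _ _ RM; apply: RM; [apply: hu|apply: hv].
Qed.

HB.instance Definition _ :=
  GRing.isSubringClosed.Build (ambient S) cluster_subring cluster_subringP.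

Lemma cluster_variable_sub u : cluster_variable u -> u \in cluster_subring.
Proof. by move=> hu; apply/asboolP => R _; apply. Qed.

(* mu_{u_l} o ... o mu_{u_1,S} (v) for a sequence s = (u_1, ..., u_l):       *)
(* follows the variable v of the initial seed along s; all other elements    *)
(* of the ambient field (in particular the integers) are fixed.              *)
Definition follow (s : seq (ambient S)) v : ambient S :=
  if position (initial S) v is Some x then mvar (mutate_seq (initial S) s) x
  else v.

Lemma mutate_seq_admissible M s :
  exists2 s', admissible M s' & mutate_seq M s = mutate_seq M s'.
Proof.
elim: s M => [|u s IH] M /=; first by exists [::].
have [s' as' es'] := IH (mutate M u).
have [hu|hu] := pselect (exists2 x, mexch M x & mvar M x = u).
  by exists (u :: s').
suff E : mutate M u = M by rewrite E in as' es'; rewrite E; exists s'.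
rewrite /mutate /position; case: pselect => // h.
case: ifPn => // /set_mem hx; case: hu; exists (xchoose h) => //.
exact/eqP/(xchooseP h).
Qed.

Lemma follow_sub s v : v \in cluster_subring -> follow s v \in cluster_subring.
Proof.
rewrite /follow; case: position => // x _; apply: cluster_variable_sub.
exists (mutate_seq (initial S) s); last by exists x.
by have [s' as' ->] := mutate_seq_admissible (initial S) s; exists s'.
Qed.

Lemma indet_sub x : indet x \in cluster_subring.
Proof.
apply: cluster_variable_sub; exists (initial S); last by exists x.
by exists [::].
Qed.
End Mutation.

(* A rooted cluster algebra is determined by, and considered together with,  *)
(* its initial seed, so [seed] is the type of objects of Clus.               *)
Record cluster_algebra (S : seed) := ClusterAlgebra {
  ca_val : ambient S;
  ca_valP : ca_val \in @cluster_subring S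
}.

HB.instance Definition _ (S : seed) := [isSub for @ca_val S].
HB.instance Definition _ (S : seed) := [Choice of cluster_algebra S by <:].
HB.instance Definition _ (S : seed) :=
  [SubChoice_isSubComNzRing of cluster_algebra S by <:].

Definition ca_var (S : seed) (x : seed_idx S) : cluster_algebra S :=
  ClusterAlgebra (indet_sub x).

Definition ca_follow (S : seed) (s : seq (cluster_algebra S))
    (a : cluster_algebra S) : cluster_algebra S :=
  ClusterAlgebra (follow_sub (map val s) (ca_valP a)).

Definition ca_admissible (S : seed) (s : seq (cluster_algebra S)) : Prop :=
  admissible (initial S) (map val s).

Definition biadmissible (S S' : seed)
    (f : cluster_algebra S -> cluster_algebra S') (s : seq (cluster_algebra S)) :=
  ca_admissible s /\ ca_admissible (map f s).

Definition is_integer (S : seed) (a : cluster_algebra S) : Prop :=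
  exists n : int, a = n%:~R.

Record clus_hom (S S' : seed) := ClusHom {
  clus_fun :> {rmorphism cluster_algebra S -> cluster_algebra S'};
  clus_CM1 : forall x, (exists x', clus_fun (ca_var x) = ca_var x')
                       \/ is_integer (clus_fun (ca_var x));
  clus_CM2 : forall x, exch x ->
    (exists2 x', exch x' & clus_fun (ca_var x) = ca_var x')
    \/ is_integer (clus_fun (ca_var x));
  clus_CM3 : forall s, biadmissible clus_fun s -> forall y,
    clus_fun (ca_follow s (ca_var y))
    = ca_follow (map clus_fun s) (clus_fun (ca_var y))
}.

Definition is_product (S1 S2 P : seed) (p1 : clus_hom P S1) (p2 : clus_hom P S2) :=
  forall (T : seed) (f1 : clus_hom T S1) (f2 : clus_hom T S2),
    exists h : clus_hom T P,
      [/\ p1 \o h =1 f1, p2 \o h =1 f2 &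
          forall h' : clus_hom T P,
            p1 \o h' =1 f1 -> p2 \o h' =1 f2 -> h' =1 h].

(* Main.v *)
(* The square of T0, the algebra Z[x1, x2] with both variables frozen, does not
   exist. Make x1 exchangeable, with exchange relation either x1 x1' = 2 or
   x1 x1' = 1 + x2. In both cases evaluation at (1, 1) and at (2, 3) is
   integer-valued, and gives a pair of morphisms to T0, hence a morphism to the
   product P. Restricted to T0 the two pairs agree, so uniqueness forces both
   morphisms to P to send x1 to the same z, an exchangeable variable since its
   projections 1 and 2 differ. By (CM3) the mutated variable x1' is then also
   sent to the same element, so 2 and 1 + x2 have the same image in P;
   projecting to the second factor gives 2 = 1 + 3. *)
From HB Require Import structures.
From mathcomp Require Import all_boot all_order all_algebra finmap.
From mathcomp Require Import monalg.
From mathcomp Require Import boolp classical_sets functions cardinality fsbigop.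
From mathcomp Require Import ring.
Require Import Defs.
Set Implicit Arguments.
Unset Strict Implicit.
Unset Printing Implicit Defensive.
Import Order.TTheory GRing.Theory Num.Theory.
Local Open Scope ring_scope.
Local Open Scope classical_set_scope.

(** * Integer values of fractions at a point *)

Section Values.
Variables (D : idomainType) (eval : {rmorphism D -> rat}).

(* u is regular at the point defining eval, with the integer value n there *)
Definition takes (u : {fraction D}) (n : int) : Prop :=
  exists p d : D, [/\ eval d != 0,
    u * FracField.tofrac d = FracField.tofrac p & eval p = n%:~R * eval d].

(** Cross-multiplying two representations of [u] gives an identity in [D], because [D] embeds in its
    fraction field, and [eval] can be applied to it. *)
Lemma takes_fun u m n : takes u m -> takes u n -> m = n.
Proof.
move=> [p [d [d0 ud pd]]] [q [e [e0 ue qe]]].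
have : p * e = q * d.
  by apply/eqP; rewrite -tofrac_eq !rmorphM /= -ud -ue mulrAC.
move=> /(congr1 eval); rewrite !rmorphM /= pd qe -!mulrA [eval e * _]mulrC.
by move=> /(mulIf (mulf_neq0 d0 e0)) /intr_inj.
Qed.

Lemma takes_int n : takes n%:~R n.
Proof.
exists n%:~R, 1; split; first by rewrite rmorph1 oner_neq0.
  by rewrite rmorph1 mulr1 rmorph_int.
by rewrite rmorph1 mulr1 rmorph_int.
Qed.

Lemma takesB t u m n : takes t m -> takes u n -> takes (t - u) (m - n).
Proof.
move=> [p [d [d0 ud pd]]] [q [e [e0 ue qe]]].
exists (p * e - q * d), (d * e); split.
- by rewrite rmorphM mulf_neq0.
- rewrite rmorphB !rmorphM /= -ud -ue mulrBl mulrA; congr (_ - _).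
  by rewrite mulrA mulrAC.
- by rewrite rmorphB !rmorphM /= pd qe intrB; ring.
Qed.

Lemma takesM t u m n : takes t m -> takes u n -> takes (t * u) (m * n).
Proof.
move=> [p [d [d0 ud pd]]] [q [e [e0 ue qe]]].
exists (p * q), (d * e); split.
- by rewrite rmorphM mulf_neq0.
- by rewrite !rmorphM /= -ud -ue mulrACA.
- by rewrite !rmorphM /= pd qe mulrACA.
Qed.

Lemma takesD t u m n : takes t m -> takes u n -> takes (t + u) (m + n).
Proof.
move=> tm un; rewrite -[u]opprK -[n]opprK; apply: takesB => //.
by rewrite -[- u]sub0r -[- n]sub0r; apply: takesB => //; apply: (takes_int 0).
Qed.

Lemma takes_neq0 u n : takes u n -> n != 0 -> u != 0.
Proof.
move=> un; apply: contra_neq => u0; rewrite u0 in un.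
exact: takes_fun un (takes_int 0).
Qed.

(** A quotient of integer values need not be an integer, so the value of [t] is given as a multiple
    of [n]. Since [m * n != 0], [n] is nonzero and the new denominator [d * q] does not vanish at
    the point. *)
Lemma takesV t u m n : u != 0 -> m * n != 0 ->
  takes t (m * n) -> takes u n -> takes (t / u) m.
Proof.
move=> u0 n0 [p [d [d0 ud pd]]] [q [e [e0 ue qe]]].
have n1 : n%:~R != 0 :> rat.
  by rewrite intr_eq0; apply: contra_neq n0 => ->; rewrite mulr0.
exists (p * e), (d * q); split.
- by rewrite rmorphM /= qe !mulf_neq0.
- move: ud; rewrite -{1}(divfK u0 t) !rmorphM /= -ue => <-.
  by rewrite mulrA -[in RHS]mulrA mulrACA.
- by rewrite !rmorphM /= pd qe; ring.
Qed.

Lemma takes_tofrac p n : eval p = n%:~R -> takes (FracField.tofrac p) n.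
Proof. by move=> pn; exists p, 1; rewrite !rmorph1 !mulr1 oner_neq0. Qed.
End Values.

(** * Evaluation of polynomials in two variables at an integer point *)

Section Evaluation.
Variable v : bool -> int.

Definition eval_mon (m : {cmonom bool}) : rat :=
  (v true)%:~R ^+ m true * (v false)%:~R ^+ m false.

Lemma eval_mon_morph : mmorphism eval_mon.
Proof.
split=> [m1 m2|]; rewrite /eval_mon; last by rewrite !cm1 mulr1.
by rewrite !cmM !exprD mulrACA.
Qed.

HB.instance Definition _ :=
  isMultiplicative.Build {cmonom bool} rat eval_mon eval_mon_morph.

Definition eval : {rmorphism cpoly bool -> rat} := mmap idfun eval_mon.

Lemma eval_ucm i : eval << 1 *g ucm i >> = (v i)%:~R.
Proof.
rewrite /eval /= mmapU mul1r /eval_mon !ucmE.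
by case: i; rewrite ?mulr1 ?mul1r.
Qed.

Lemma takes_indet i : takes eval (indet i) (v i).
Proof. rewrite indet.unlock; apply: takes_tofrac (eval_ucm i). Qed.
End Evaluation.

(** * Generalities on mutation, and seeds without exchangeable variables *)

Section CaVal.
Variable S : seed.
Implicit Types a c : cluster_algebra S.

Lemma ca_val1 : ca_val (1 : cluster_algebra S) = 1.
Proof. exact: (rmorph1 val). Qed.

Lemma ca_valD a c : ca_val (a + c) = ca_val a + ca_val c.
Proof. exact: (rmorphD val). Qed.

Lemma ca_valB a c : ca_val (a - c) = ca_val a - ca_val c.
Proof. exact: (rmorphB val). Qed.

Lemma ca_valM a c : ca_val (a * c) = ca_val a * ca_val c.
Proof. by []. Qed.
End CaVal.

Lemma mutate_cases (S : seed) (M : mseed S) u :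
  mutate M u = M \/ exists2 x, mexch M x & mutate M u = mutate_at M x.
Proof.
rewrite /mutate; case: position => [x|]; last by left.
by case: ifPn => [/set_mem xM|_]; [right; exists x|left].
Qed.

Lemma position_mvar (S : seed) (M : mseed S) x :
  injective (mvar M) -> position M (mvar M x) = Some x.
Proof.
move=> inj; rewrite /position; case: pselect => [h|[]]; last by exists x.
by congr Some; apply: inj; apply/eqP; apply: (xchooseP h).
Qed.

Lemma ca_follow_nil (S : seed) (a : cluster_algebra S) : ca_follow [::] a = a.
Proof.
apply: val_inj; rewrite /= /follow /position; case: pselect => //= h.
exact/eqP/(xchooseP h).
Qed.

Section Frozen.
Variables (S : seed) (S0 : forall x : seed_idx S, ~ exch x).

Lemma frozen_admissible (s : seq (ambient S)) :
  admissible (initial S) s -> s = [::].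
Proof. by case: s => // u s [[x /S0]]. Qed.

(** If the source or the target has only frozen variables, this reduces (CM3) to the empty
    sequence. *)
Lemma frozen_ca_admissible (s : seq (cluster_algebra S)) :
  ca_admissible s -> s = [::].
Proof. by move=> /frozen_admissible; case: s. Qed.

Lemma frozen_cluster_variable (u : ambient S) :
  cluster_variable u -> exists x, u = indet x.
Proof. by move=> [_ [s /frozen_admissible -> ->] [x <-]]; exists x. Qed.
End Frozen.

(** * The seeds on two variables and their integer-valued points *)

Section TwoVariables.
Variables e b : bool.

Definition two_exmat (x y : bool) : int :=
  if x == y then 0 else if x then b%:Z else - b%:Z.

Lemma two_row_finite x : finite_set [set y | two_exmat x y != 0].
Proof. exact: finite_finset. Qed.

Lemma two_col_finite y : finite_set [set x | two_exmat x y != 0].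
Proof. exact: finite_finset. Qed.

Lemma two_skew : exists d : bool -> nat, (forall x, (0 < d x)%N) /\
  (forall x y, (d x)%:Z * two_exmat x y = - ((d y)%:Z * two_exmat y x)).
Proof.
exists (fun=> 1%N); split=> // -[] [];
  by rewrite !mul1r /two_exmat /= ?oppr0 ?opprK.
Qed.

(* Indices true and false stand for x1 and x2: x1 is exchangeable iff e, x2 is
   frozen, and the exchange relation is x1 x1' = numer. *)
Definition two_seed : seed :=
  @Seed bool (fun x => e && x) two_exmat two_row_finite two_col_finite two_skew.

(** For [b] false the matrix is zero and both exchange monomials are empty products, whence 1 +
    1. *)
Definition numer : ratfun bool := if b then indet false + 1 else 2%:R.

Lemma fsbig_bool (f : bool -> int) (F : bool -> ratfun bool) (P : pred int) :
  f true = 0 -> ~~ P 0 ->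
  \big[*%R/1]_(y \in [set y | P (f y)]) F y = if P (f false) then F false else 1.
Proof.
move=> f0 P0; case: ifPn => Pf.
  rewrite (_ : [set y | _] = [set false]) ?fsbig_set1 //.
  by apply/seteqP; split=> -[] //=; rewrite f0 (negbTE P0).
rewrite (_ : [set y | _] = set0) ?fsbig_set0 //.
by apply/seteqP; split=> -[] //=; rewrite ?f0 ?(negbTE P0) ?(negbTE Pf).
Qed.

(** A change of sign in the matrix only swaps the two exchange monomials, so their sum is
    unaffected. *)
Lemma new_var_two (M : mseed two_seed) : mvar M false = indet false ->
  mmat M true true = 0 ->
  mmat M true false = b%:Z \/ mmat M true false = - b%:Z ->
  new_var M true = numer / mvar M true.
Proof.
move=> Mf Mt Mb; rewrite /new_var; congr (_ / _).
have P0 : ~~ (0 < 0 :> int) by [].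
rewrite (@fsbig_bool (mmat M true) _ (fun n => 0 < n)) //.
rewrite (@fsbig_bool (mmat M true) _ (fun n => n < 0)) //.
rewrite Mf /numer; case: Mb => ->; case: b => //=.
by rewrite opprK addrC.
Qed.

(** An invariant of mutation: only x1 can be mutated, which exchanges x1 with [numer / x1] and flips
    the sign of the matrix. *)
Definition reachable_two (M : mseed two_seed) := [/\ mexch M = (fun x => e && x),
  mvar M false = indet false,
  mvar M true = indet true \/ mvar M true = numer / indet true &
  mmat M true true = 0 /\
  (mmat M true false = b%:Z \/ mmat M true false = - b%:Z)].

Lemma reachable_initial : reachable_two (initial two_seed).
Proof. by split=> //; [left|split=> //; left]. Qed.

Lemma reachable_mutate M u : numer != 0 ->
  reachable_two M -> reachable_two (mutate M u).
Proof.
move=> N0 RM; case: (mutate_cases M u) => [->//|[x]].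
case: RM => Me Mf Mt [Mtt Mtf]; rewrite Me => /andP[_]; case: x => // _ ->.
split=> //=.
- rewrite new_var_two //; case: Mt => ->; [by right|left].
  by rewrite invf_div mulrC divfK.
- rewrite /new_mat /= Mtt oppr0; split=> //.
  by case: Mtf => ->; rewrite ?opprK; [right|left].
Qed.

Lemma reachable_Mut M : numer != 0 -> Mut M -> reachable_two M.
Proof.
move=> N0 [s _ ->]; rewrite /mutate_seq.
elim: s (initial _) reachable_initial => //= u s IH M0 RM0.
exact/IH/reachable_mutate.
Qed.

Lemma numer_neq0 : numer != 0.
Proof.
suff [n n0 Nn] : exists2 n, n != 0 & takes (eval (fun=> 1)) numer n.
  exact: takes_neq0 Nn n0.
(* At the point (1, 1) both 1 + x2 and the constant numerator have the value 2. *)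
rewrite /numer; exists 2 => //; case: b; last exact: (takes_int _ 2).
by apply: takesD (takes_int _ 1); apply: takes_indet.
Qed.

Definition numer_val (w : bool -> int) : int := if b then w false + 1 else 2.

Variable w : bool -> int.
Hypotheses (w_neq0 : numer_val w != 0) (w_dvd : (w true %| numer_val w)%Z).

Lemma takes_numer : takes (eval w) numer (numer_val w).
Proof.
rewrite /numer /numer_val; case: b; last exact: (takes_int _ 2).
by apply: takesD (takes_int _ 1); apply: takes_indet.
Qed.

(** The only variable besides x1 and x2 is [numer / x1], whose value is an integer by [w_dvd]. The
    value of x1 divides a nonzero integer, so it is nonzero. *)
Lemma takes_cluster_variable (u : ambient two_seed) :
  cluster_variable u -> exists n, takes (eval w) u n.
Proof.
move=> [M MM [x <-]].
have [_ Mf Mt _] := reachable_Mut numer_neq0 MM.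
case: x; last by rewrite Mf; exists (w false); apply: takes_indet.
case: Mt => ->; first by exists (w true); apply: takes_indet.
have /dvdzP[k Nk] := w_dvd; exists k.
have w0 : w true != 0 by apply: contra_neq w_neq0 => w0; rewrite Nk w0 mulr0.
have xw := takes_indet w true.
apply: takesV (takes_neq0 xw w0) _ _ xw; rewrite -Nk //; exact: takes_numer.
Qed.

(** The fractions with an integer value at [w] form a subring containing the cluster variables, and
    the cluster algebra lies in every such subring. *)
Lemma takes_cluster (a : cluster_algebra two_seed) :
  exists n, takes (eval w) (ca_val a) n.
Proof.
pose R : {pred ambient two_seed} := fun u => `[< exists n, takes (eval w) u n >].
have /asboolP /(_ R) aR := ca_valP a.
apply/asboolP/aR => [|u /takes_cluster_variable].
  split=> [|t u /asboolP[m tm] /asboolP[n un]|t u /asboolP[m tm] /asboolP[n un]].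
  - by apply/asboolP; exists 1; apply: (takes_int _ 1).
  - by apply/asboolP; exists (m - n); apply: takesB.
  - by apply/asboolP; exists (m * n); apply: takesM.
by move=> uR; apply/asboolP.
Qed.

Definition ca_eval (a : cluster_algebra two_seed) : int :=
  projT1 (cid (takes_cluster a)).

Lemma ca_evalP (a : cluster_algebra two_seed) n :
  takes (eval w) (ca_val a) n -> ca_eval a = n.
Proof. by apply: takes_fun; rewrite /ca_eval; case: cid. Qed.

Lemma takes_ca_eval (a : cluster_algebra two_seed) :
  takes (eval w) (ca_val a) (ca_eval a).
Proof. by rewrite /ca_eval; case: cid. Qed.

Lemma ca_eval_zmod_morphism : zmod_morphism ca_eval.
Proof.
move=> a c; apply: ca_evalP; rewrite ca_valB.
exact: takesB (takes_ca_eval a) (takes_ca_eval c).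
Qed.

Lemma ca_eval_monoid_morphism : monoid_morphism ca_eval.
Proof.
split=> [|a c]; apply: ca_evalP; first exact: (takes_int _ 1).
rewrite ca_valM.
exact: takesM (takes_ca_eval a) (takes_ca_eval c).
Qed.

HB.instance Definition _ := GRing.isZmodMorphism.Build
  (cluster_algebra two_seed) int ca_eval ca_eval_zmod_morphism.
HB.instance Definition _ := GRing.isMonoidMorphism.Build
  (cluster_algebra two_seed) int ca_eval ca_eval_monoid_morphism.

Lemma ca_eval_var x : ca_eval (@ca_var two_seed x) = w x.
Proof. by apply/ca_evalP/takes_indet. Qed.

(** * Evaluation as a rooted cluster morphism to an algebra with only frozen variables *)

Section EvalHom.
Variables (S : seed) (S0 : forall x : seed_idx S, ~ exch x).

Definition int_eval : {rmorphism cluster_algebra two_seed -> cluster_algebra S} :=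
  intmul 1 \o ca_eval.

Lemma int_eval_integer a : is_integer (int_eval a).
Proof. by exists (ca_eval a). Qed.

Lemma int_eval_CM3 s : biadmissible int_eval s -> forall y : seed_idx two_seed,
  int_eval (ca_follow s (ca_var y)) =
  ca_follow (map int_eval s) (int_eval (ca_var y)).
Proof.
move=> [_ /(frozen_ca_admissible S0)]; case: s => // _ y.
by rewrite !ca_follow_nil.
Qed.

Definition eval_hom : clus_hom two_seed S :=
  ClusHom (fun x => or_intror (int_eval_integer (ca_var x)))
    (fun x _ => or_intror (int_eval_integer (ca_var x))) int_eval_CM3.
End EvalHom.
End TwoVariables.

(** * The exchange relation as an identity in the cluster algebra *)

Lemma indet_bool_inj : injective (@indet bool).
Proof.
(* The point with x1 = 1 and x2 = 0 separates the two indeterminates. *)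
move=> x y xy; have := takes_indet (fun z => z%:Z) x; rewrite xy => yx.
have := takes_fun yx (takes_indet (fun z => z%:Z) y).
by case: x y {xy yx} => -[].
Qed.

Lemma two_exchange b :
  let x1 : cluster_algebra (two_seed true b) := @ca_var (two_seed true b) true in
  x1 * ca_follow [:: x1] x1 =
  if b then @ca_var (two_seed true b) false + 1 else 2%:R.
Proof.
set x1 := @ca_var (two_seed true b) true => /=.
have inj : injective (mvar (initial (two_seed true b))) by exact: indet_bool_inj.
have pos := position_mvar (true : seed_idx (two_seed true b)) inj.
have x0 : indet true != 0 :> ratfun bool.
  exact: takes_neq0 (takes_indet (fun=> 1) true) _.
have fol : ca_val (ca_follow [:: x1] x1) = numer b / indet true.
  rewrite /= /follow [position _ _]pos /= /mutate [position _ _]pos.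
  rewrite mem_set //= new_var_two //.
  by left.
apply: val_inj; rewrite [LHS]ca_valM fol mulrC divfK // /numer.
by case: (b); rewrite [RHS]ca_valD ca_val1.
Qed.

Lemma frozen_two_seed b (x : seed_idx (two_seed false b)) : ~ exch x.
Proof. by []. Qed.

(** * Restriction of morphisms along the inclusion that unfreezes x1 *)

Section Inclusion.
Variables b b' : bool.
Local Notation T0 := (two_seed false b).
Local Notation T1 := (two_seed true b').

(** Both algebras lie in the same field, and the cluster variables of [T0] are just the two
    indeterminates, which are initial variables of [T1] as well. *)
Lemma two_subring_sub (u : ratfun bool) :
  u \in @cluster_subring T0 -> u \in @cluster_subring T1.
Proof.
move=> /asboolP; apply; first exact: cluster_subringP.
move=> v /(frozen_cluster_variable (@frozen_two_seed b))[x ->].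
exact: (@indet_sub T1).
Qed.

Definition two_incl (a : cluster_algebra T0) : cluster_algebra T1 :=
  @ClusterAlgebra T1 (ca_val a) (two_subring_sub (ca_valP a)).

Lemma two_incl_zmod_morphism : zmod_morphism two_incl.
Proof.
move=> a c; apply: val_inj; rewrite [RHS]ca_valB.
exact: (@ca_valB T0).
Qed.

Lemma two_incl_monoid_morphism : monoid_morphism two_incl.
Proof.
split=> [|a c]; apply: val_inj; first exact: (@ca_val1 T0).
rewrite [RHS]ca_valM.
exact: (@ca_valM T0).
Qed.

HB.instance Definition _ := GRing.isZmodMorphism.Build
  (cluster_algebra T0) (cluster_algebra T1) two_incl two_incl_zmod_morphism.
HB.instance Definition _ := GRing.isMonoidMorphism.Build
  (cluster_algebra T0) (cluster_algebra T1) two_incl two_incl_monoid_morphism.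

Lemma two_incl_var x : two_incl (@ca_var T0 x) = @ca_var T1 x.
Proof. exact: val_inj. Qed.

Lemma ca_eval_incl w (N0 : numer_val b w != 0)
    (dvd0 : (w true %| numer_val b w)%Z)
    (N1 : numer_val b' w != 0)
    (dvd1 : (w true %| numer_val b' w)%Z)
    (a : cluster_algebra T0) :
  ca_eval N1 dvd1 (two_incl a) = ca_eval N0 dvd0 a.
Proof. by apply: ca_evalP; exact: (takes_ca_eval N0 dvd0 a). Qed.

Section Restriction.
Variables (S : seed) (h : clus_hom T1 S).

Definition restr_fun : {rmorphism cluster_algebra T0 -> cluster_algebra S} :=
  h \o two_incl.

Lemma restr_CM1 (x : seed_idx T0) :
  (exists x', restr_fun (ca_var x) = ca_var x')
  \/ is_integer (restr_fun (ca_var x)).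
Proof. by rewrite /= two_incl_var; apply: clus_CM1. Qed.

Lemma restr_CM2 (x : seed_idx T0) : exch x ->
  (exists2 x', exch x' & restr_fun (ca_var x) = ca_var x')
  \/ is_integer (restr_fun (ca_var x)).
Proof. by move=> /frozen_two_seed. Qed.

Lemma restr_CM3 s : biadmissible restr_fun s -> forall y : seed_idx T0,
  restr_fun (ca_follow s (ca_var y)) =
  ca_follow (map restr_fun s) (restr_fun (ca_var y)).
Proof.
move=> [/(frozen_ca_admissible (@frozen_two_seed b)) -> _] y.
by rewrite !ca_follow_nil.
Qed.

Definition restr : clus_hom T0 S := ClusHom restr_CM1 restr_CM2 restr_CM3.
End Restriction.
End Inclusion.

Theorem proposition5p4 :
  exists S1 S2 : seed,
    ~ exists (P : seed) (p1 : clus_hom P S1) (p2 : clus_hom P S2),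
        is_product p1 p2.
Proof.
pose T0 := two_seed false false; exists T0, T0 => -[P [p1 [p2 prodP]]].
(* x1 divides both 2 and 1 + x2 at each of these points *)
pose w1 (x : bool) : int := 1; pose w2 (x : bool) : int := if x then 2 else 3.
have w1N b : numer_val b w1 != 0 by case: b.
have w2N b : numer_val b w2 != 0 by case: b.
have w1d b : (w1 true %| numer_val b w1)%Z by case: b.
have w2d b : (w2 true %| numer_val b w2)%Z by case: b.
have T0fr := @frozen_two_seed false.
pose f1 e b := @eval_hom e b w1 (w1N b) (w1d b) T0 T0fr.
pose f2 e b := @eval_hom e b w2 (w2N b) (w2d b) T0 T0fr.
have f1x e b x : f1 e b (@ca_var (two_seed e b) x) = (w1 x)%:~R.
  by rewrite /= ca_eval_var.
have f2x e b x : f2 e b (@ca_var (two_seed e b) x) = (w2 x)%:~R.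
  by rewrite /= ca_eval_var.
(* Evaluation at [w1] is a ring homomorphism to the integers, hence separates them. *)
have intr_T0 (m n : int) : m%:~R = n%:~R :> cluster_algebra T0 -> m = n.
  move=> /(congr1 (ca_eval (w1N false) (w1d false))).
  by rewrite !rmorph_int !intz.
(* Only the uniqueness of [k] matters: it identifies any two morphisms from [T0] to [P] with these
   projections. *)
have [k [_ _ k_uniq]] := prodP T0 (f1 false false) (f2 false false).
have [h hP] : exists h : forall b, clus_hom (two_seed true b) P,
    forall b, p1 \o h b =1 f1 true b /\ p2 \o h b =1 f2 true b.
  have ex b : {h : clus_hom (two_seed true b) P |
      p1 \o h =1 f1 true b /\ p2 \o h =1 f2 true b}.
    by apply: cid; have [h [h1 h2 _]] := prodP _ (f1 true b) (f2 true b); exists h.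
  by exists (fun b => projT1 (ex b)) => b; case: (ex b).
have p1h b x : p1 (h b (@ca_var (two_seed true b) x)) = (w1 x)%:~R.
  by rewrite -(f1x true b); case: (hP b) => /(_ (@ca_var (two_seed true b) x)).
have p2h b x : p2 (h b (@ca_var (two_seed true b) x)) = (w2 x)%:~R.
  by rewrite -(f2x true b); case: (hP b) => _ /(_ (@ca_var (two_seed true b) x)).
have hk b : restr false (h b) =1 k.
  have [h1 h2] := hP b; apply: k_uniq => a /=.
    by rewrite [LHS]h1 /= (ca_eval_incl (w1N false) (w1d false)).
  by rewrite [LHS]h2 /= (ca_eval_incl (w2N false) (w2d false)).
have hz b : h b (@ca_var (two_seed true b) true) = k (@ca_var T0 true).
  by rewrite -(hk b) /= two_incl_var.
have exch_true b : exch (true : seed_idx (two_seed true b)) by [].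
have [z zP kz] : exists2 z : seed_idx P, exch z & k (@ca_var T0 true) = ca_var z.
  have [|[n hn]] := clus_CM2 (h false) (exch_true false).
    by case=> z zP hzz; exists z; rewrite // -hzz hz.
  (* An integer image [n] of x1 would be kept by both projections, but these send x1 to 1 and to
     2. *)
  have := p1h false true; rewrite hn rmorph_int => /intr_T0 n1.
  by have := p2h false true; rewrite hn n1 rmorph_int => /intr_T0.
pose z1 := ca_var z; pose Z := z1 * ca_follow [:: z1] z1.
(* The element [Z] does not depend on [b]: (CM3) for the one-term sequence x1 carries the exchange
   relation of either seed to the mutation of [P] at [z]. *)
have ZE b : Z = h b (if b then @ca_var (two_seed true b) false + 1 else 2%:R).
  rewrite -(two_exchange b) rmorphM clus_CM3 /=; last first.
    split; split=> //; first by exists true.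
    by rewrite hz kz; exists z.
  by rewrite hz kz.
(* The second projection is needed here: x2 has the value 3 there, giving 2 = 3 + 1, whereas the
   first would give only 2 = 1 + 1. *)
have := ZE true; rewrite (ZE false) => /(congr1 p2).
rewrite /= !rmorphD !rmorph1 p2h -(intrD _ _ 1).
by move=> /(intr_T0 2).
Qed.
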